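(* Let $(\mathfrak{g},\pi,T)$ be an extended Rota-Baxter Lie algebra of weight $(\mu,\lambda)$ and $(V,T_V)$ an extended Rota-Baxter representation of it. For $n\ge0$ set $$C^n_{\mathrm{RBA}_{(\mu,\lambda)}}(\mathfrak{g},V)=\mathrm{Hom}(\wedge^n\mathfrak{g},V)\oplus\mathrm{Hom}(\wedge^{n-1}\mathfrak{g},V),$$ regarded as a subspace of $C^n_{\mathrm{RBA}_{(\mu,\lambda)}}(\mathfrak{g}\ltimes V)=\mathrm{Hom}(\wedge^n(\mathfrak{g}\oplus V),\mathfrak{g}\oplus V)\oplus\mathrm{Hom}(\wedge^{n-1}(\mathfrak{g}\oplus V),\mathfrak{g}\oplus V)$ via the natural injection (a map on $\wedge^k\mathfrak{g}$ with values in $V$ is extended by zero on the components $\wedge^p\mathfrak{g}\otimes\wedge^qV$ with $q\ge1$ of $\wedge^k(\mathfrak{g}\oplus V)$). Then $C^*_{\mathrm{RBA}_{(\mu,\lambda)}}(\mathfrak{g},V)$ is a subcomplex of the cochain complex $(C^*_{\mathrm{RBA}_{(\mu,\lambda)}}(\mathfrak{g}\ltimes V),\partial_{\mathrm{RBA}_{(\mu,\lambda)}})$ of the extended Rota-Baxter Lie algebra $\mathfrak{g}\ltimes V$. (It is called the cochain complex of $(\mathfrak{g},\pi,T)$ with coefficients in $(V,T_V)$.)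
   Context: $\mathbf{k}$ is a field of characteristic $0$, $\mu,\lambda\in\mathbf{k}$, and $\mathbf{k}$ contains a square root of $\mu^2-4\lambda$. An extended Rota-Baxter Lie algebra of weight $(\mu,\lambda)$ is a Lie algebra $(\mathfrak{g},\pi=[-,-])$ with a linear map $T:\mathfrak{g}\to\mathfrak{g}$ such that $[Ta,Tb]=T([Ta,b]+[a,Tb]+\mu[a,b])+\lambda[a,b]$. An extended Rota-Baxter representation is a Lie algebra representation $(V,\rho)$, written $[a,m]:=\rho(a)m$, with a linear map $T_V:V\to V$ such that $[Ta,T_Vm]=T_V([a,T_Vm]+[Ta,m]+\mu[a,m])+\lambda[a,m]$. The semi-direct product $\mathfrak{g}\ltimes V$ is $\mathfrak{g}\oplus V$ with bracket $[(a,m),(b,n)]=([a,b],[a,n]-[b,m])$ and operator $T\oplus T_V$; it is an extended Rota-Baxter Lie algebra of weight $(\mu,\lambda)$. Constants: $B_0=0$, $B_1=1$, $B_{n+1}=\mu B_n-\lambda B_{n-1}$; $A_n=\lambda B_n$ for $n\ge0$, $A_{-1}=-1$. Cochain complex of an extended Rota-Baxter Lie algebra $(\mathfrak{h},\pi,S)$ of weight $(\mu,\lambda)$: $C^n=\mathrm{Hom}(\wedge^n\mathfrak{h},\mathfrak{h})\oplus\mathrm{Hom}(\wedge^{n-1}\mathfrak{h},\mathfrak{h})$ with $\partial_{\mathrm{RBA}_{(\mu,\lambda)}}(f,g)=(\partial_{\mathrm{Lie}}f,\,-\partial_{\mathrm{RB}}g-\delta f)$, where, for $f\in\mathrm{Hom}(\wedge^n\mathfrak{h},\mathfrak{h})$,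 $$\partial_{\mathrm{Lie}}(f)(x_1,\dots,x_{n+1})=\sum_{i=1}^{n+1}(-1)^{i+n}[x_i,f(x_1,\dots,\hat x_i,\dots,x_{n+1})]+\sum_{i<j}(-1)^{i+j+n+1}f([x_i,x_j],x_1,\dots,\hat x_i,\dots,\hat x_j,\dots,x_{n+1}),$$ $$\partial_{\mathrm{RB}}(f)(x_1,\dots,x_{n+1})=\sum_{i=1}^{n+1}(-1)^{i+n}\big([Sx_i,f(\dots\hat x_i\dots)]-S[x_i,f(\dots\hat x_i\dots)]\big)+\sum_{i<j}(-1)^{i+j+n+1}f([Sx_i,x_j]+[x_i,Sx_j]+\mu[x_i,x_j],x_1,\dots,\hat x_i,\dots,\hat x_j,\dots,x_{n+1}),$$ $$\delta(f)(x_1,\dots,x_n)=-\sum_{k=0}^n\sum_{\tau\in\mathrm{Sh}(k,n-k)}\mathrm{sgn}(\tau)A_{n-k-1}f(Sx_{\tau(1)},\dots,Sx_{\tau(k)},x_{\tau(k+1)},\dots,x_{\tau(n)})-\sum_{k=1}^n\sum_{\tau\in\mathrm{Sh}(k-1,n-k+1)}\mathrm{sgn}(\tau)B_{n-k+1}S f(Sx_{\tau(1)},\dots,Sx_{\tau(k-1)},x_{\tau(k)},\dots,x_{\tau(n)}).$$ $\mathrm{Sh}(p,q)$ denotes $(p,q)$-shuffles. *)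

(* Defs.v *)
(* MathComp; sets and the pointwise module structure on function types are
   those of mathcomp-classical. *)
From HB Require Import structures.
From mathcomp Require Import all_boot all_order all_fingroup all_algebra.
From mathcomp Require Import boolp classical_sets functions.

Set Implicit Arguments.
Unset Strict Implicit.
Unset Printing Implicit Defensive.

Import GRing.Theory.
Local Open Scope ring_scope.

Record is_lie_bracket (k : fieldType) (h : lmodType k) (br : h -> h -> h) :
    Prop := IsLieBracket {
  lie_linearl : forall y, linear (br^~ y);
  lie_linearr : forall x, linear (br x);
  lie_alternating : forall x, br x x = 0;
  lie_jacobi : forall x y z,
    br x (br y z) + br y (br z x) + br z (br x y) = 0 }.

Record is_lie_rep (k : fieldType) (g V : lmodType k) (br : g -> g -> g)
    (rho : g -> V -> V) : Prop := IsLieRep {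
  rep_linearl : forall m, linear (rho^~ m);
  rep_linearr : forall a, linear (rho a);
  rep_bracket : forall a b m,
    rho (br a b) m = rho a (rho b m) - rho b (rho a m) }.

Record is_extRB_lie (k : fieldType) (mu lambda : k) (g : lmodType k)
    (br : g -> g -> g) (T : g -> g) : Prop := IsExtRBLie {
  extRB_lie : is_lie_bracket br;
  extRB_linear : linear T;
  extRB_eq : forall a b,
    br (T a) (T b)
    = T (br (T a) b + br a (T b) + mu *: br a b) + lambda *: br a b }.

Record is_extRB_rep (k : fieldType) (mu lambda : k) (g V : lmodType k)
    (br : g -> g -> g) (T : g -> g) (rho : g -> V -> V) (TV : V -> V) :
    Prop := IsExtRBRep {
  extRB_rep : is_lie_rep br rho;
  extRB_rep_linear : linear TV;
  extRB_rep_eq : forall a m,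
    rho (T a) (TV m)
    = TV (rho a (TV m) + rho (T a) m + mu *: rho a m) + lambda *: rho a m }.

Section SemiDirect.

Variables (k : fieldType) (g V : lmodType k).

Definition sd_bracket (br : g -> g -> g) (rho : g -> V -> V)
    (x y : g * V) : g * V :=
  (br x.1 y.1, rho x.1 y.2 - rho y.1 x.2).

Definition sd_op (T : g -> g) (TV : V -> V) (x : g * V) : g * V :=
  (T x.1, TV x.2).

End SemiDirect.

Lemma sd_extRB_lie (k : fieldType) (mu lambda : k) (g V : lmodType k)
    (br : g -> g -> g) (T : g -> g) (rho : g -> V -> V) (TV : V -> V) :
  is_extRB_lie mu lambda br T -> is_extRB_rep mu lambda br T rho TV ->
  is_extRB_lie mu lambda (sd_bracket br rho) (sd_op T TV).
Proof.
move=> [[bl br' ba bj] Tl Te] [[rl rr rb] TVl TVe].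
have rhoB a : {morph rho a : x y / x - y}.
  by move=> x y; rewrite -[x - y]addrC -scaleN1r rr scaleN1r addrC.
have TVB : {morph TV : x y / x - y}.
  by move=> x y; rewrite -[x - y]addrC -scaleN1r TVl scaleN1r addrC.
have cl (W : lmodType k) (a : k) (u v u' v' : W) :
    a *: u + v - (a *: u' + v') = a *: (u - u') + (v - v').
  by rewrite scalerBr opprD addrACA.
split; [split|..].
- by move=> y a x z; rewrite /sd_bracket /= bl rl rr cl.
- by move=> y a x z; rewrite /sd_bracket /= br' rl rr cl.
- by move=> x; rewrite /sd_bracket ba subrr.
- move=> x y z; rewrite /sd_bracket /=; congr (_, _); first exact: bj.
  have E (a b c d : V) : a - b - (c - d) = a + d - (b + c).
    by rewrite opprB addrACA opprD.
  rewrite !rhoB !rb !E [X in _ - X + _ + _]addrC subrKA.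
  by rewrite [X in _ - X + _]addrC subrKA [X in X - _]addrC subrr.
- by move=> a x y; rewrite /sd_op /= Tl TVl.
- move=> a b; rewrite /sd_bracket /sd_op /=; congr (_, _); first exact: Te.
  rewrite !TVe opprD addrACA -scalerBr -TVB; congr (TV _ + _).
  rewrite /= scalerBr opprD addrACA; congr (_ + _).
  by rewrite [X in X - _]addrC opprD addrACA.
Qed.

(* 'I_n -> h is the type of n-tuples of elements of h;
   [eta x with i |-> v] is the tuple x whose i-th entry is replaced by v. *)
Section Multilinear.

Variables (k : fieldType) (h W : lmodType k).

(* Hom(wedge^n h, W) *)
Definition alt_hom n : set (('I_n -> h) -> W) := [set f : ('I_n -> h) -> W |
  (forall (x : 'I_n -> h) i, linear (fun v : h => f [eta x with i |-> v])) /\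
  (forall (x : 'I_n -> h) i j, i != j -> x i = x j -> f x = 0)].

(* The underlying space of a pair (f, g) of an n-ary and an (n-1)-ary map.
   In degree 0, where the second summand Hom(wedge^(-1) h, W) is 0, the type
   of the second component is only a placeholder: RBA_cochain forces it
   to be 0. *)
Definition RBA_space n : lmodType k :=
  (((('I_n -> h) -> W) * (('I_n.-1 -> h) -> W))%type : lmodType k).

Definition RBA_cochain n : set (RBA_space n) := [set c |
  alt_hom c.1 /\ (if n is _.+1 then alt_hom c.2 else c.2 = 0)].

End Multilinear.

Section Tuples.

Variable h : Type.

Definition omit n (x : 'I_n.+1 -> h) (i : 'I_n.+1) : 'I_n -> h :=
  fun l => x (lift i l).

(* (c, x_1, .., ^x_i, .., ^x_j, .., x_(n+1)), meant for i < j.  The entry in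
   position l > 0 is the (l-1)-st of the entries of x left when those of
   indices i and j are omitted, namely the one of index
   bump j (bump i l.-1) <= n. *)
Definition contract n (c : h) (x : 'I_n.+1 -> h) (i j : 'I_n.+1) :
    'I_n -> h :=
  fun l => if (l == 0 :> nat)%N then c else x (inord (bump j (bump i l.-1))).

End Tuples.

(* Permutations of {0, .., n-1} increasing on {0, .., p-1} and on
   {p, .., n-1}, i.e. the (p, n-p)-shuffles. *)
Definition is_shuffle n (p : nat) (tau : 'S_n) : bool :=
  [forall i : 'I_n, forall j : 'I_n,
     ((i < j) && ((j < p) || (p <= i)))%N ==> (tau i < tau j)%N].

Section Complex.

Variables (k : fieldType) (mu lambda : k).

Fixpoint B (n : nat) : k :=
  match n with
  | 0 => 0
  | m.+1 => match m with
            | 0 => 1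
            | m'.+1 => mu * B m - lambda * B m'
            end
  end.

(* Only the indices >= -1 are used. *)
Definition A (i : int) : k :=
  match i with
  | Posz n => lambda * B n
  | Negz _ => -1
  end.

Variables (h : lmodType k) (br : h -> h -> h) (S : h -> h).

(* In the formulas below indices start at 0, so that i.+1 is the position
   of x i counted from 1. *)
Definition d_Lie n (f : ('I_n -> h) -> h) : ('I_n.+1 -> h) -> h := fun x =>
  \sum_(i < n.+1) (-1) ^+ (i.+1 + n) *: br (x i) (f (omit x i))
  + \sum_(i < n.+1) \sum_(j < n.+1 | (i < j)%N)
      (-1) ^+ (i.+1 + j.+1 + n.+1) *: f (contract (br (x i) (x j)) x i j).

Definition d_RB n (f : ('I_n -> h) -> h) : ('I_n.+1 -> h) -> h := fun x =>
  \sum_(i < n.+1) (-1) ^+ (i.+1 + n) *: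
      (br (S (x i)) (f (omit x i)) - S (br (x i) (f (omit x i))))
  + \sum_(i < n.+1) \sum_(j < n.+1 | (i < j)%N)
      (-1) ^+ (i.+1 + j.+1 + n.+1) *:
      f (contract (br (S (x i)) (x j) + br (x i) (S (x j))
                   + mu *: br (x i) (x j)) x i j).

(* (S x_(tau 1), .., S x_(tau p), x_(tau (p+1)), .., x_(tau n)) *)
Definition shuffle_arg n (p : nat) (tau : 'S_n) (x : 'I_n -> h) : 'I_n -> h :=
  fun i => if (i < p)%N then S (x (tau i)) else x (tau i).

Definition delta n (f : ('I_n -> h) -> h) : ('I_n -> h) -> h := fun x =>
  - (\sum_(0 <= p < n.+1) \sum_(tau : 'S_n | is_shuffle p tau)
       (-1) ^+ tau *: (A (n%:Z - p%:Z - 1) *: f (shuffle_arg p tau x)))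
  - (\sum_(1 <= p < n.+1) \sum_(tau : 'S_n | is_shuffle p.-1 tau)
       (-1) ^+ tau *: (B (n - p).+1 *: S (f (shuffle_arg p.-1 tau x)))).

Definition d_RBA n : RBA_space h h n -> RBA_space h h n.+1 :=
  match n with
  | 0 => fun c => (d_Lie c.1, - delta c.1)
  | _.+1 => fun c => (d_Lie c.1, - d_RB c.2 - delta c.1)
  end.

End Complex.

Section Complexes.

Variables (k : fieldType) (X : nat -> lmodType k).
Variable d : forall n, X n -> X n.+1.

Definition is_subspace (M : lmodType k) (U : set M) : Prop :=
  U 0 /\ forall (a : k) u v, U u -> U v -> U (a *: u + v).

Definition is_cochain_complex (C : forall n, set (X n)) : Prop :=
  forall n, [/\ is_subspace (C n),
    forall x, C n x -> C n.+1 (d x),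
    forall (a : k) x y, C n x -> C n y -> d (a *: x + y) = a *: d x + d y
    & forall x, C n x -> d (d x) = 0].

Definition is_subcomplex (D C : forall n, set (X n)) : Prop :=
  is_cochain_complex C /\
  forall n, [/\ is_subspace (D n),
    forall x, D n x -> C n x
    & forall x, D n x -> D n.+1 (d x)].

End Complexes.

Section NaturalInjection.

Variables (k : fieldType) (g V : lmodType k).

(* Composition with the projection wedge^n (g + V) -> wedge^n g, whose kernel
   is the sum of the wedge^p g (x) wedge^q V with q >= 1; see ext_alt_hom,
   ext_on_g, ext_on_V and ext_unique. *)
Definition ext n (f : ('I_n -> g) -> V) : ('I_n -> g * V) -> g * V :=
  fun x => (0, f (fun i => (x i).1)).

Definition nat_inj n (c : RBA_space g V n) :
    RBA_space (g * V)%type (g * V)%type n :=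
  (ext c.1, ext c.2).

Definition RBA_coef_cochain n :
    set (RBA_space (g * V)%type (g * V)%type n) :=
  (@nat_inj n) @` (@RBA_cochain k g V n).

Lemma nat_inj_injective n : injective (@nat_inj n).
Proof.
have extI m : injective (@ext m).
  move=> f f' /funeqP eqf; apply/funext => x.
  by have [] := eqf (fun i => (x i, 0)).
by move=> [f g1] [f' g1'] [/extI-> /extI->].
Qed.

Lemma ext_alt_hom n (f : ('I_n -> g) -> V) : alt_hom f -> alt_hom (ext f).
Proof.
move=> [fl fa]; split=> [x i a u v|x i j ij xij]; rewrite /ext.
  have E w : (fun l => ([eta x with i |-> w] l).1)
             = [eta (fun l => (x l).1) with i |-> w.1] :> ('I_n -> g).
    by apply/funext => l /=; case: ifP.
  by rewrite !E fl; congr (_, _); rewrite /= scaler0 addr0.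
by rewrite (fa _ i j ij) //= xij.
Qed.

Lemma ext_on_g n (f : ('I_n -> g) -> V) x :
  ext f (fun i => (x i, 0)) = (0, f x).
Proof. by []. Qed.

Lemma ext_on_V n (f : ('I_n -> g) -> V) (x : 'I_n -> g * V) i :
  alt_hom f -> (x i).1 = 0 -> ext f x = 0.
Proof.
move=> [fl _] xi0; rewrite /ext; congr (_, _).
set y := fun l => _; have := fl y i (-1) 0 0.
rewrite scaler0 addr0 scaleN1r addNr => <-; congr f.
by apply/funext => l /=; case: eqP => // ->; rewrite /y xi0.
Qed.

Lemma ext_unique n (f : ('I_n -> g) -> V) (F : ('I_n -> g * V) -> g * V) :
    alt_hom F ->
    (forall x : 'I_n -> g, F (fun i => (x i, 0)) = (0, f x)) ->
    (forall x i, (x i).1 = 0 -> F x = 0) ->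
  F = ext f.
Proof.
move=> [Fl _] Fg FV; apply/funext => x.
pose y m : 'I_n -> g * V := fun i => if (i < m)%N then ((x i).1, 0) else x i.
have step m : F (y m) = F (y m.+1).
  have [nm|mn] := leqP n m.
    congr F; apply/funext => i; rewrite /y.
    by rewrite !(leq_trans (ltn_ord i)) // (leq_trans nm).
  pose i := Ordinal mn; have := Fl (y m) i 1 ((x i).1, 0) (0, (x i).2).
  rewrite !scale1r [F [eta _ with i |-> (0, _)]](FV _ i) /= ?eqxx // addr0.
  have yE (w : g * V) m' : y m' i = w -> (forall l, l != i -> y m' l = y m l) ->
      [eta y m with i |-> w] = y m' :> ('I_n -> g * V).
    by move=> wE E; apply/funext => l /=; case: eqVneq => [->//|/E].
  rewrite (yE _ m) => [|//|//]; last first.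
    by rewrite /y /= ltnn; case: (x i) => a b; congr (_, _); rewrite /= ?addr0 ?add0r.
  rewrite (yE _ m.+1) => [//||l li]; rewrite /y /= ?ltnSn //.
  by rewrite ltnS leq_eqVlt (_ : (l == m :> nat) = false) //; apply: negbTE.
have Fy m : F x = F (y m).
  elim: m => [|m ->]; last exact: step.
  by congr F; apply/funext => i; rewrite /y ltn0.
rewrite (Fy n).
rewrite (_ : y n = fun i => ((x i).1, 0)) ?Fg //.
by apply/funext => i; rewrite /y ltn_ord.
Qed.

End NaturalInjection.

(* Main.v *)
Require Import Defs.
From HB Require Import structures.
From mathcomp Require Import all_boot all_order all_fingroup all_algebra.
From mathcomp Require Import boolp classical_sets functions.

(* Up to the sign (-1)^(n+1), d_Lie and d_RB are Chevalley-Eilenberg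
   differentials: d_Lie that of (h, br) with adjoint coefficients, d_RB that of
   the descendent Lie algebra [x, y]_S = [S x, y] + [x, S y] + mu [x, y] acting
   on h by v |-> [S x, v] - S [x, v].  They square to zero and preserve
   alternating maps by induction on the degree, through Cartan's formulas
   i_a d = L_a - d i_a and i_b L_a = L_a i_b - i_[a, b].

   Let R = k[eps] / (eps^2 - mu eps + lambda).  The extended Rota-Baxter
   equation says that phi = S + eps : (h, [,]_S) -> h (x) R is a Lie morphism,
   so f |-> f (phi, .., phi) commutes with the differentials.  It also says
   that u + eps w |-> u - S w is a morphism of modules from h (x) R to the
   module of d_RB.  As eps^m = B_m eps - A_(m-1), expanding
   f (phi x_1, .., phi x_n) over the subsets of {1, .., n}, that is over
   shuffles, shows that delta f is the composition of the two maps; hence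
   delta d_Lie = d_RB delta. *)

Set Implicit Arguments.
Unset Strict Implicit.
Unset Printing Implicit Defensive.

Import GRing.Theory.
Local Open Scope ring_scope.

(** * Alternating maps *)

Section LinearMaps.

Variables (k : pzRingType) (M N : lmodType k) (f : M -> N).
Hypothesis fl : linear f.

Lemma linD u v : f (u + v) = f u + f v.
Proof. by have := fl 1 u v; rewrite !scale1r. Qed.

Lemma lin0 : f 0 = 0.
Proof. by apply: (addrI (f 0)); rewrite -linD !addr0. Qed.

Lemma linZ a u : f (a *: u) = a *: f u.
Proof. by rewrite -[a *: u]addr0 fl lin0 addr0. Qed.

Lemma linN u : f (- u) = - f u.
Proof. by rewrite -scaleN1r linZ scaleN1r. Qed.

Lemma linB u v : f (u - v) = f u - f v.
Proof. by rewrite linD linN. Qed.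

End LinearMaps.

Section TupleCons.

Variable h : Type.

Definition tcons n (a : h) (y : 'I_n -> h) : 'I_n.+1 -> h :=
  fun i => if unlift ord0 i is Some j then y j else a.

(** The interior product [i_a], on arbitrary maps of tuples. *)
Definition insert W n (a : h) (f : ('I_n.+1 -> h) -> W) : ('I_n -> h) -> W :=
  fun y => f (tcons a y).

Lemma tcons0 n a (y : 'I_n -> h) : tcons a y ord0 = a.
Proof. by rewrite /tcons unlift_none. Qed.

Lemma tconsS n a (y : 'I_n -> h) j : tcons a y (lift ord0 j) = y j.
Proof. by rewrite /tcons liftK. Qed.

Lemma tuple_eqP n (x x' : 'I_n.+1 -> h) :
  x ord0 = x' ord0 -> (forall j, x (lift ord0 j) = x' (lift ord0 j)) -> x = x'.
Proof.
by move=> x0 xS; apply/funext => i; case: (unliftP ord0 i) => [j|] ->.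
Qed.

Lemma tcons_eta n (x : 'I_n.+1 -> h) : tcons (x ord0) (omit x ord0) = x.
Proof. by apply: tuple_eqP => [|j]; rewrite ?tcons0 ?tconsS. Qed.

Lemma omit_tcons0 n a (y : 'I_n -> h) : omit (tcons a y) ord0 = y.
Proof. by apply/funext => j; rewrite /omit tconsS. Qed.

Lemma omit_tconsS n a (y : 'I_n.+1 -> h) i :
  omit (tcons a y) (lift ord0 i) = tcons a (omit y i).
Proof.
apply: tuple_eqP => [|j]; rewrite /omit ?tcons0 ?tconsS.
  by rewrite (_ : lift _ _ = ord0) ?tcons0 //; apply: val_inj.
rewrite -[RHS](tconsS a y); congr tcons.
by apply: val_inj; rewrite /= /bump /= !add1n ltnS addnS.
Qed.

Lemma tcons_with0 n a v (y : 'I_n -> h) :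
  [eta tcons a y with ord0 |-> v] = tcons v y :> ('I_n.+1 -> h).
Proof. by apply: tuple_eqP => [|j] /=; rewrite ?tcons0 ?tconsS. Qed.

Lemma tcons_withS n a i v (y : 'I_n -> h) :
  [eta tcons a y with lift ord0 i |-> v]
  = tcons a [eta y with i |-> v] :> ('I_n.+1 -> h).
Proof.
by apply: tuple_eqP => [|j]; rewrite /= ?tcons0 ?tconsS.
Qed.

(* contract reads the entries of x through inord, hence the index i' in 'I_n.+1
   with the value of i. *)
Lemma contractE n c (x : 'I_n.+2 -> h) (i j : 'I_n.+2) (i' : 'I_n.+1) :
  i = i' :> nat -> contract c x i j = tcons c (omit (omit x j) i').
Proof.
move=> ii'; apply: tuple_eqP => [|l]; rewrite /contract ?tcons0 ?tconsS //=.
rewrite /omit ii'; congr x; apply: val_inj => /=.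
by rewrite inordK //; exact: (ltn_ord (lift j (lift i' l))).
Qed.

Lemma contract_tcons0 n c a (y : 'I_n.+1 -> h) j :
  contract c (tcons a y) ord0 (lift ord0 j) = tcons c (omit y j).
Proof. by rewrite (@contractE _ _ _ _ _ ord0) // omit_tconsS omit_tcons0. Qed.

(** The common tail [z] compares the brackets of pairs inside [y] before and after [a] is put in
    front. *)
Lemma contract_tconsS n c a (y : 'I_n.+2 -> h) (i j : 'I_n.+2) : (i < j)%N ->
  exists z, contract c y i j = tcons c z
    /\ contract c (tcons a y) (lift ord0 i) (lift ord0 j) = tcons c (tcons a z).
Proof.
move=> ij; have lti : (i < n.+1)%N by rewrite -ltnS (leq_trans _ (ltn_ord j)).
pose i' := Ordinal lti; exists (omit (omit y j) i'); split.
  exact: contractE.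
by rewrite (@contractE _ _ _ _ _ (lift ord0 i')) // !omit_tconsS.
Qed.

End TupleCons.

Section Alternating.

Variables (k : fieldType) (h W : lmodType k).
Implicit Types (a b : h).

Lemma insert_linear n (f : ('I_n.+1 -> h) -> W) :
  alt_hom f -> linear (fun a => insert a f).
Proof.
move=> [fl _] c u v; apply/funext => y.
by have := fl (tcons 0 y) ord0 c u v; rewrite !tcons_with0.
Qed.

Lemma alt_insert n (f : ('I_n.+1 -> h) -> W) a :
  alt_hom f -> alt_hom (insert a f).
Proof.
move=> [fl fa]; split=> [y i c u v|y i j ij yij]; rewrite /insert.
  by rewrite -!tcons_withS fl.
by apply: (fa _ (lift ord0 i) (lift ord0 j));
  rewrite ?tconsS // (inj_eq (@lift_inj _ ord0)).
Qed.

Lemma alt_diag n (f : ('I_n.+2 -> h) -> W) a z :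
  alt_hom f -> f (tcons a (tcons a z)) = 0.
Proof.
move=> [_ fa].
by apply: (fa _ ord0 (lift ord0 ord0)); rewrite ?tconsS ?tcons0.
Qed.

(** Polarization: with [u] at [i] and [v] at [j] in [y u v], the value of [f] at
    [y (x i + x j) (x i + x j)] is 0 and expands into [f x + f (x \o tperm i j)]. *)
Lemma alt_swap n (f : ('I_n -> h) -> W) (x : 'I_n -> h) i j :
  alt_hom f -> i != j -> f (x \o tperm i j) = - f x.
Proof.
move=> [fl fa] ij; apply/eqP; rewrite -addr_eq0; apply/eqP.
pose y (u v : h) : 'I_n -> h := [eta [eta x with i |-> u] with j |-> v].
have yi u v : y u v i = u by rewrite /y /= eqxx (negbTE ij).
have yj u v : y u v j = v by rewrite /y /= eqxx.
have yC u v : y u v = [eta [eta x with j |-> v] with i |-> u].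
  apply/funext => l; rewrite /y /=; case: eqP => [->|//].
  by rewrite eq_sym (negbTE ij).
have yDr u v w : f (y u (v + w)) = f (y u v) + f (y u w).
  exact: (linD (fl _ j)).
have yDl u v w : f (y (u + v) w) = f (y u w) + f (y v w).
  by rewrite !yC; exact: (linD (fl _ i)).
have y0 u : f (y u u) = 0 by apply: (fa _ i j) => //; rewrite yi yj.
have := y0 (x i + x j); rewrite yDl !yDr !y0 add0r addr0 => <-.
rewrite addrC; congr (f _ + f _); apply/funext => l; rewrite /y /=.
  by case: eqP => [->//|_]; case: eqP => [->//|_].
case: tpermP => [->|->|/eqP/negbTE-> /eqP/negbTE->//].
  by rewrite eqxx (negbTE ij).
by rewrite eqxx.
Qed.

Lemma alt_perm n (f : ('I_n -> h) -> W) (x : 'I_n -> h) (s : 'S_n) :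
  alt_hom f -> f (x \o s) = (-1) ^+ s *: f x.
Proof.
move=> fA; have [ts -> tsP] := prod_tpermP s.
elim: ts x tsP => [|t ts IH] x /=.
  rewrite big_nil odd_perm1 scale1r => _; congr f; apply/funext => i /=.
  by rewrite perm1.
case/andP => tP /IH {}IH; rewrite big_cons odd_mul_tperm tP signr_addb mulN1r.
set s' := (\prod_(i <- ts) _)%g in IH *.
have -> : x \o (tperm t.1 t.2 * s')%g = (x \o s') \o tperm t.1 t.2.
  by apply/funext => i /=; rewrite permM.
by rewrite alt_swap // IH scaleNr.
Qed.

Lemma alt_move n (f : ('I_n.+1 -> h) -> W) (x : 'I_n.+1 -> h) j :
  alt_hom f -> f (tcons (x j) (omit x j)) = (-1) ^+ j *: f x.
Proof.
(* [lift_perm ord0 j 1] is the cycle bringing entry [j] to the front, of sign [(-1) ^+ j]. *)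
move=> fA; have := alt_perm x (lift_perm ord0 j 1) fA.
rewrite odd_lift_perm odd_perm1 addbF /= signr_odd => <-; congr f.
apply: tuple_eqP => [|l] /=; first by rewrite tcons0 lift_perm_id.
by rewrite tconsS lift_perm_lift perm1.
Qed.

Lemma alt_swap_head n (f : ('I_n.+2 -> h) -> W) a b z :
  alt_hom f -> f (tcons a (tcons b z)) = - f (tcons b (tcons a z)).
Proof.
move=> fA; have := alt_move (tcons b (tcons a z)) (lift ord0 ord0) fA.
by rewrite tconsS tcons0 omit_tconsS omit_tcons0 expr1 scaleN1r.
Qed.

(** Criterion for inductions on the degree: coincidences within the tail are covered by the interior
    products, those with the first entry by the last hypothesis. *)
Lemma alt_ofS n (F : ('I_n.+1 -> h) -> W) :
  (forall a, alt_hom (insert a F)) ->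
  linear (fun a => insert a F) ->
  (forall a y j, y j = a -> F (tcons a y) = 0) -> alt_hom F.
Proof.
move=> FA Fl F0; split=> [x i|x i j].
  rewrite -(tcons_eta x); case: (unliftP ord0 i) => [l|] -> c u v.
    by rewrite !tcons_withS; have [+ _] := FA (x ord0); apply.
  by rewrite !tcons_with0; apply: (congr1 (@^~ _) (Fl c u v)).
rewrite -(tcons_eta x).
case: (unliftP ord0 i) => [i'|] ->; case: (unliftP ord0 j) => [j'|] ->;
  rewrite ?tcons0 ?tconsS ?eqxx // => ij eqx.
- have [_ +] := FA (x ord0); apply; last exact: eqx.
  by apply: contraNneq ij => ->.
- exact: F0 eqx.
- exact: F0 (esym eqx).
Qed.

(* By antisymmetry in the tail, only coincidences of the first two entries
   have to be examined. *)
Lemma alt_ofSS n (F : ('I_n.+2 -> h) -> W) :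
  (forall a, alt_hom (insert a F)) ->
  linear (fun a => insert a F) ->
  (forall a z, F (tcons a (tcons a z)) = 0) -> alt_hom F.
Proof.
move=> FA Fl F0; apply: alt_ofS => // a y j yj.
have := alt_move y j (FA a); rewrite /insert yj F0 => /esym/eqP.
by rewrite scaler_eq0 signr_eq0 => /eqP.
Qed.

Lemma alt_of1 (F : ('I_1 -> h) -> W) :
  linear (fun a => insert a F) -> alt_hom F.
Proof.
move=> Fl; split=> [x i c u v|x i j]; last by rewrite !ord1.
rewrite !ord1 -(tcons_eta x) !tcons_with0.
exact: (congr1 (@^~ _) (Fl c u v)).
Qed.

Lemma alt_of0 (F : ('I_0 -> h) -> W) : alt_hom F.
Proof. by split=> [x []|x []]. Qed.

Lemma funLE X c (f f' : X -> W) (x : X) : (c *: f + f') x = c *: f x + f' x.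
Proof. by []. Qed.

Lemma fun0E X (x : X) : (0 : X -> W) x = 0.
Proof. by []. Qed.

Lemma alt_subspace n : is_subspace (@alt_hom k h W n).
Proof.
split=> [|c f f' [fl fa] [fl' fa']].
  by split=> // x i c u v; rewrite !fun0E scaler0 addr0.
split=> [x i d u v|x i j ij xij]; rewrite !funLE.
  by rewrite fl fl' !scalerDr !scalerA addrACA [c * d]mulrC.
by rewrite (fa _ i j) // (fa' _ i j) // scaler0 addr0.
Qed.

Lemma alt_lin n c (f f' : ('I_n -> h) -> W) :
  alt_hom f -> alt_hom f' -> alt_hom (c *: f + f').
Proof. by have [_] := @alt_subspace n; apply. Qed.

Lemma alt_sub n (f f' : ('I_n -> h) -> W) :
  alt_hom f -> alt_hom f' -> alt_hom (f - f').
Proof. by move=> fA fA'; rewrite -scaleN1r addrC; apply: alt_lin. Qed.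

Lemma alt_scale n c (f : ('I_n -> h) -> W) : alt_hom f -> alt_hom (c *: f).
Proof.
move=> fA; rewrite -[c *: f]addr0; apply: alt_lin => //.
by have [] := @alt_subspace n.
Qed.

End Alternating.

(** * Cartan calculus *)

(** The leading [0] lets [addrAC] move every term in [zmod_eq], the first included. *)
Lemma sub0_eq (M : zmodType) (u v : M) : 0 + u - v = 0 -> u = v.
Proof. by rewrite add0r => /eqP; rewrite subr_eq0 => /eqP. Qed.

Ltac generalize_atoms t :=
  lazymatch t with
  | (?u + ?v)%R => generalize_atoms u; generalize_atoms v
  | (- ?u)%R => generalize_atoms u
  | 0%R => idtac
  | _ => tryif is_var t then idtac else
      (let z := fresh "z" in set z := t; clearbody z)
  end.

(* Identities between sums of terms and opposites of terms in a zmodType: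
   for every x occurring as - x, both - x and x are moved to the end. *)
Ltac zmod_eq :=
  lazymatch goal with |- ?u = ?v => generalize_atoms u; generalize_atoms v end;
  apply: sub0_eq; rewrite !(opprD, opprK, oppr0, addr0, addrA);
  repeat match goal with |- context [- ?x] =>
    repeat (progress rewrite (addrAC _ (- x) _));
    repeat (progress rewrite (addrAC _ x _)); rewrite (addrNK x) end;
  reflexivity.

Section Cartan.

Variables (k : fieldType) (L M : lmodType k).
Variables (br : L -> L -> L) (act : L -> M -> M).
Implicit Types (a b : L).

(* Lie derivative along a, defined by i_b L_a = L_a i_b - i_[a, b] *)
Fixpoint ce_lie a n : (('I_n -> L) -> M) -> ('I_n -> L) -> M :=
  match n with
  | 0 => fun f x => act a (f x)
  | _.+1 => fun f x =>
      ce_lie a (insert (x ord0) f) (omit x ord0)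
      - f (tcons (br a (x ord0)) (omit x ord0))
  end.

(* Chevalley-Eilenberg differential, defined by Cartan's formula
   i_a d = L_a - d i_a *)
Fixpoint ce_diff n : (('I_n -> L) -> M) -> ('I_n.+1 -> L) -> M :=
  match n with
  | 0 => fun f x => act (x ord0) (f (omit x ord0))
  | _.+1 => fun f x =>
      ce_lie (x ord0) f (omit x ord0)
      - ce_diff (insert (x ord0) f) (omit x ord0)
  end.

(** Drives the inductions on the degree: an identity is checked after applying every [i_a], which
    Cartan's formulas bring one degree down. *)
Lemma insert_inj n (f f' : ('I_n.+1 -> L) -> M) :
  (forall a, insert a f = insert a f') -> f = f'.
Proof.
move=> ff'; apply/funext => x; rewrite -(tcons_eta x).
exact: (congr1 (@^~ _) (ff' _)).
Qed.

Lemma insert_lie n a b (f : ('I_n.+1 -> L) -> M) :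
  insert b (ce_lie a f) = ce_lie a (insert b f) - insert (br a b) f.
Proof. by apply/funext => y; rewrite /insert /= tcons0 omit_tcons0. Qed.

Lemma insert_diff n a (f : ('I_n.+1 -> L) -> M) :
  insert a (ce_diff f) = ce_lie a f - ce_diff (insert a f).
Proof. by apply/funext => y; rewrite /insert /= tcons0 omit_tcons0. Qed.

Lemma insert_diff0 a (f : ('I_0 -> L) -> M) :
  insert a (ce_diff f) = ce_lie a f.
Proof. by apply/funext => y; rewrite /insert /= tcons0 omit_tcons0. Qed.

Lemma funBE (X : Type) (f f' : X -> M) x : (f - f') x = f x - f' x.
Proof. by []. Qed.

Lemma funZE (X : Type) c (f : X -> M) x : (c *: f) x = c *: f x.
Proof. by []. Qed.

Lemma insert_diag n a (f : ('I_n.+2 -> L) -> M) :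
  alt_hom f -> insert a (insert a f) = 0.
Proof. by move=> fA; apply/funext => y; exact: alt_diag. Qed.

Lemma lieS n a (f : ('I_n.+1 -> L) -> M) x :
  ce_lie a f x = ce_lie a (insert (x ord0) f) (omit x ord0)
                 - insert (br a (x ord0)) f (omit x ord0).
Proof. by []. Qed.

Lemma insertE n a (f : ('I_n.+1 -> L) -> M) y : insert a f y = f (tcons a y).
Proof. by []. Qed.

Lemma insertL n a c (f f' : ('I_n.+1 -> L) -> M) :
  insert a (c *: f + f') = c *: insert a f + insert a f'.
Proof. by []. Qed.

Lemma insertB n a (f f' : ('I_n.+1 -> L) -> M) :
  insert a (f - f') = insert a f - insert a f'.
Proof. by []. Qed.

End Cartan.

Section CartanLinear.

Variables (k : fieldType) (L M : lmodType k).
Variables (br : L -> L -> L) (act : L -> M -> M).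
Hypothesis act_lin : forall a, linear (act a).
Notation ce_lie := (ce_lie br act).
Notation ce_diff := (ce_diff br act).

Lemma lie_linear n a : linear (fun f : ('I_n -> L) -> M => ce_lie a f).
Proof.
elim: n => [|n IH] c f f'; first by apply/funext => x; exact: act_lin.
apply: insert_inj => b; rewrite !(insertL, insert_lie) IH scalerBr.
by zmod_eq.
Qed.

Lemma diff_linear n : linear (fun f : ('I_n -> L) -> M => ce_diff f).
Proof.
elim: n => [|n IH] c f f'; first by apply/funext => x; exact: act_lin.
apply: insert_inj => a.
rewrite insertL !insert_diff scalerBr insertL IH lie_linear.
by zmod_eq.
Qed.

End CartanLinear.

Section LieModule.

Variables (k : fieldType) (L M : lmodType k).
Variables (br : L -> L -> L) (act : L -> M -> M).
Hypotheses (brP : is_lie_bracket br) (actP : is_lie_rep br act).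
Implicit Types (a b : L).
Notation ce_lie := (ce_lie br act).
Notation ce_diff := (ce_diff br act).
Let lie_linear n a := @lie_linear k L M br act (rep_linearr actP) n a.
Let diff_linear n := @diff_linear k L M br act (rep_linearr actP) n.

Lemma lie_linear_arg n (f : ('I_n -> L) -> M) :
  alt_hom f -> linear (fun a => ce_lie a f).
Proof.
elim: n f => [|n IH] f fA c u v.
  by apply/funext => x; exact: (rep_linearl actP).
apply: insert_inj => b.
rewrite insertL !insert_lie (IH _ (alt_insert b fA)) (lie_linearl brP).
by rewrite (insert_linear fA) scalerBr; zmod_eq.
Qed.

(** In [i_b i_b L_a f] the term [L_a i_b i_b f] vanishes, and the two terms in [i_b] and [i_[a, b]]
    cancel by antisymmetry. *)
Lemma alt_lie n a (f : ('I_n -> L) -> M) : alt_hom f -> alt_hom (ce_lie a f).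
Proof.
elim: n f => [|n IH] f fA; first exact: alt_of0.
have lieA b : alt_hom (insert b (ce_lie a f)).
  rewrite insert_lie; apply: alt_sub; last exact: alt_insert.
  exact/IH/alt_insert.
have liel : linear (fun b => insert b (ce_lie a f)).
  move=> c u v; rewrite !insert_lie (insert_linear fA) lie_linear.
  rewrite (lie_linearr brP) (insert_linear fA).
  by rewrite scalerBr; zmod_eq.
case: n => [|n] in f fA IH lieA liel *; first exact: alt_of1.
apply: alt_ofSS => // b z.
rewrite -!insertE insert_lie insertB insert_lie insert_diag //.
rewrite (lin0 (lie_linear _)) sub0r funBE.
by rewrite -[(- _) z]/(- (_ z)) !insertE alt_swap_head // opprK addrC addNr.
Qed.

(** [i_a i_a d f = L_a i_a f - i_[a, a] f - i_a d i_a f], where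
    [i_a d i_a f = L_a i_a f - d i_a i_a f] and [i_a i_a f = 0]. *)
Lemma alt_diff n (f : ('I_n -> L) -> M) : alt_hom f -> alt_hom (ce_diff f).
Proof.
elim: n f => [|n IH] f fA.
  apply: alt_of1 => c u v; rewrite !insert_diff0.
  by rewrite (lie_linear_arg fA).
have diffA a : alt_hom (insert a (ce_diff f)).
  rewrite insert_diff; apply: alt_sub; first exact: alt_lie.
  exact/IH/alt_insert.
apply: alt_ofSS => [//|c u v|a z].
  rewrite !insert_diff scalerBr (lie_linear_arg fA) (insert_linear fA).
  by rewrite diff_linear; zmod_eq.
rewrite -!insertE insert_diff insertB insert_lie.
rewrite (lie_alternating brP) (lin0 (insert_linear fA)) subr0.
case: n => [|n] in f fA IH diffA z *; first by rewrite insert_diff0 subrr.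
by rewrite insert_diff insert_diag // (lin0 (@diff_linear _)) subr0 subrr.
Qed.

Lemma br_anti a b : br a b = - br b a.
Proof.
apply/eqP; rewrite -addr_eq0; apply/eqP.
have := lie_alternating brP (a + b).
rewrite (linD (lie_linearl brP _)) !(linD (lie_linearr brP _)).
by rewrite !(lie_alternating brP) add0r addr0.
Qed.

Lemma br_jacobi a b c : br (br a b) c = br a (br b c) - br b (br a c).
Proof.
have := lie_jacobi brP a b c; rewrite [br c (br a b)]br_anti [br c a]br_anti.
by rewrite (linN (lie_linearr brP _)) => /eqP; rewrite subr_eq0 => /eqP.
Qed.

(** After applying [i_c], the mixed terms cancel in pairs and those without Lie derivative cancel by
    the Jacobi identity. *)
Lemma lie_bracket n a b (f : ('I_n -> L) -> M) : alt_hom f ->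
  ce_lie (br a b) f = ce_lie a (ce_lie b f) - ce_lie b (ce_lie a f).
Proof.
elim: n f => [|n IH] f fA.
  by apply/funext => x; exact: (rep_bracket actP).
apply: insert_inj => c; rewrite [RHS]insertB !insert_lie.
rewrite !(linB (lie_linear _)) br_jacobi (linB (insert_linear fA)).
rewrite (IH _ (alt_insert c fA)).
by zmod_eq.
Qed.

Lemma lie_diff n a (f : ('I_n -> L) -> M) : alt_hom f ->
  ce_lie a (ce_diff f) = ce_diff (ce_lie a f).
Proof.
elim: n f => [|n IH] f fA; apply: insert_inj => b.
  by rewrite insert_lie !insert_diff0 lie_bracket //; zmod_eq.
rewrite insert_lie !insert_diff insert_lie (linB (lie_linear _)).
rewrite (linB (@diff_linear _)) (IH _ (alt_insert b fA)) lie_bracket //.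
by zmod_eq.
Qed.

(** [i_a d d f = L_a d f - d L_a f + d d i_a f]. *)
Lemma diff_diff n (f : ('I_n -> L) -> M) : alt_hom f -> ce_diff (ce_diff f) = 0.
Proof.
elim: n f => [|n IH] f fA; apply: insert_inj => a; rewrite insert_diff.
  by rewrite insert_diff0 lie_diff // subrr.
rewrite insert_diff (linB (@diff_linear _)) (IH _ (alt_insert a fA)).
by rewrite lie_diff // subr0 subrr.
Qed.

Lemma lieE n a (f : ('I_n -> L) -> M) (x : 'I_n -> L) :
  ce_lie a f x
  = act a (f x) - \sum_(j < n) f [eta x with j |-> br a (x j)].
Proof.
elim: n f x => [|n IH] f x; first by rewrite big_ord0 subr0.
rewrite lieS insertE IH insertE tcons_eta big_ord_recl opprD addrA [RHS]addrAC.
rewrite -[in RHS](tcons_eta x) tcons_with0 tcons0; congr (_ - _ - _).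
  by rewrite tcons_eta.
by apply: eq_bigr => j _; rewrite tconsS tcons_withS.
Qed.

(** Common shape of [d_Lie] and [d_RB], which are convertible to instances of it. *)
Definition ce_sum n (f : ('I_n -> L) -> M) : ('I_n.+1 -> L) -> M := fun x =>
  \sum_(i < n.+1) (-1) ^+ (i.+1 + n) *: act (x i) (f (omit x i))
  + \sum_(i < n.+1) \sum_(j < n.+1 | (i < j)%N)
      (-1) ^+ (i.+1 + j.+1 + n.+1) *: f (contract (br (x i) (x j)) x i j).

Lemma ce_sumE n (f : ('I_n -> L) -> M) : alt_hom f ->
  ce_sum f = (-1) ^+ n.+1 *: ce_diff f.
Proof.
elim: n f => [|n IH] f fA; apply/funext => x.
  rewrite /ce_sum big_ord1 big1 ?addr0 // => i _.
  by rewrite big1 // => j; rewrite !ord1.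
rewrite -(tcons_eta x); move: (x ord0) (omit x ord0) => a y {x}.
(* Cartan's formula in the signs of [ce_sum]. The terms involving the first entry, once split off,
   must give the Lie derivative. *)
have -> : ((-1) ^+ n.+2 *: ce_diff f) (tcons a y)
          = ce_sum (insert a f) y + (-1) ^+ n *: ce_lie a f y.
  rewrite (IH _ (alt_insert a fA)) !funZE -insertE insert_diff funBE scalerBr.
  by rewrite addrC 2!exprS !mulN1r opprK scaleNr.
rewrite lieE scalerBr /ce_sum big_ord_recl tcons0 omit_tcons0.
have -> : (-1) ^+ (1 + n.+1) = (-1) ^+ n :> k.
  by rewrite add1n 2!exprS !mulN1r opprK.
rewrite [X in _ + X = _]big_ord_recl [RHS]addrC [RHS]addrACA -scalerN -sumrN.
congr (_ + _ + (_ + _)).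
- apply: eq_bigr => i _; rewrite tconsS omit_tconsS insertE /= /bump add1n.
  by rewrite addSn addnS addSn 2!exprS !mulN1r opprK.
- rewrite big_mkcond big_ord_recl ltnn Monoid.mul1m scaler_sumr.
  apply: eq_bigr => j _ /=.
  rewrite tconsS tcons0 contract_tcons0.
  (* [contract] puts [[a, y_j]] in front; moving it back to position [j] gives the term of [lieE],
     up to [(-1) ^+ j]. *)
  pose z : 'I_n.+1 -> L := [eta y with j |-> br a (y j)].
  have zj : z j = br a (y j) by rewrite /z /= eqxx.
  have -> : omit y j = omit z j.
    by apply/funext => l; rewrite /omit /z /= eq_sym (negbTE (neq_lift _ _)).
  rewrite -[in LHS]zj alt_move // scalerA -exprD scalerN -scaleNr.
  congr (_ *: _); rewrite /= /bump !add1n -[RHS]mulN1r -[RHS]exprS.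
  rewrite -[LHS]signr_odd -[RHS]signr_odd; congr ((-1) ^+ nat_of_bool _).
  by rewrite /= !(oddD, oddS) /=; case: (odd j); case: (odd n).
- apply: eq_bigr => i _; rewrite big_mkcond big_ord_recl ltn0 Monoid.mul1m.
  rewrite -big_mkcond /=.
  apply: eq_big => [j|j ij]; rewrite ?tconsS /= /bump !add1n //.
  case: n IH => [|n] IH in f fA y i j ij *; first by rewrite !ord1 in ij.
  have [z [-> ->]] := contract_tconsS (br (y i) (y j)) a y ij.
  (* The bracket and [a] stand in opposite orders on the two sides; the sign of the swap makes up
     for the exponents, which differ by 3. *)
  rewrite alt_swap_head // insertE scalerN -scaleNr; congr (_ *: _).
  rewrite -[in LHS]mulN1r -[in LHS]exprS -[LHS]signr_odd -[RHS]signr_odd.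
  congr ((-1) ^+ nat_of_bool _); rewrite !(oddD, oddS) /=.
  by case: (odd i); case: (odd j); case: (odd n).
Qed.
End LieModule.

(** * Pullback along S + eps *)

Section ModuleMorphism.

Variables (k : fieldType) (L N N' : lmodType k).
Variables (br : L -> L -> L) (rho : L -> N -> N) (rho' : L -> N' -> N').
Variable p : N -> N'.
Hypotheses (pl : linear p) (p_rho : forall a v, p (rho a v) = rho' a (p v)).

Lemma comp_linear X : linear (fun F : X -> N => p \o F).
Proof. by move=> c F F'; apply/funext => x; exact: pl. Qed.

Lemma compB X (F F' : X -> N) : p \o (F - F') = (p \o F) - (p \o F').
Proof. by apply/funext => x; exact: linB. Qed.

Lemma comp_lie n a (F : ('I_n -> L) -> N) :
  p \o ce_lie br rho a F = ce_lie br rho' a (p \o F).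
Proof.
elim: n F => [|n IH] F; first by apply/funext => x; exact: p_rho.
apply: insert_inj => b.
rewrite [RHS]insert_lie -[insert b (p \o F)]/(p \o insert b F) -IH.
rewrite -[insert (br a b) (p \o F)]/(p \o insert (br a b) F).
rewrite -[LHS]/(p \o insert b (ce_lie br rho a F)) insert_lie.
exact: compB.
Qed.

(** Applied to [eps], for linearity over [R], and to [dual_proj], for the passage to the module of
    [d_RB]. *)
Lemma comp_diff n (F : ('I_n -> L) -> N) :
  p \o ce_diff br rho F = ce_diff br rho' (p \o F).
Proof.
elim: n F => [|n IH] F; first by apply/funext => x; exact: p_rho.
apply: insert_inj => b; rewrite insert_diff -comp_lie.
rewrite -[insert b (p \o F)]/(p \o insert b F) -IH.
rewrite -[LHS]/(p \o insert b (ce_diff br rho F)) insert_diff.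
exact: compB.
Qed.

Lemma alt_comp n (F : ('I_n -> L) -> N) : alt_hom F -> alt_hom (p \o F).
Proof.
move=> [Fl Fa]; split=> [x i c u v|x i j ij xij] /=.
  by rewrite Fl pl.
by rewrite (Fa _ i j) // lin0.
Qed.

End ModuleMorphism.

Section Pullback.

Variables (k : fieldType) (mu lambda : k) (L M N : lmodType k).
Variables (br : L -> L -> L) (S : L -> L) (act : L -> M -> M).
Hypothesis Sl : linear S.

Definition desc_br (x y : L) : L := br (S x) y + br x (S y) + mu *: br x y.

Hypothesis S_eq :
  forall x y, S (desc_br x y) = br (S x) (S y) - lambda *: br x y.

(* N stands for the R-module obtained from M by extension of scalars to
   R = k[eps] / (eps^2 - mu eps + lambda), and b for the action extended
   R-linearly. *)
Variables (inl : M -> N) (eps : N -> N) (b : L -> N -> N).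
Hypotheses (inll : linear inl) (epsl : linear eps).
Hypotheses (b_inl : forall x m, b x (inl m) = inl (act x m)).
Hypotheses (b_eps : forall x v, b x (eps v) = eps (b x v)).
Hypotheses (bl : forall x, linear (b x)).
Hypotheses (eps_eq : forall v, eps (eps v) = mu *: eps v - lambda *: v).

(** The action of [phi x = S x + eps x]. *)
Definition ext_act x v : N := b (S x) v + eps (b x v).

(** [f (phi x_1, .., phi x_n)], expanded one entry at a time. *)
Fixpoint pull n : (('I_n -> L) -> M) -> ('I_n -> L) -> N :=
  match n with
  | 0 => fun f x => inl (f x)
  | _.+1 => fun f x =>
      pull (insert (S (x ord0)) f) (omit x ord0)
      + eps (pull (insert (x ord0) f) (omit x ord0))
  end.

Lemma insert_pull n a (f : ('I_n.+1 -> L) -> M) :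
  insert a (pull f) = pull (insert (S a) f) + (eps \o pull (insert a f)).
Proof. by apply/funext => y; rewrite /insert /= tcons0 omit_tcons0. Qed.

Let epsL X := @comp_linear k N N eps epsl X.

Lemma pull_linear n : linear (@pull n).
Proof.
elim: n => [|n IH] c f f'; first by apply/funext => x; exact: inll.
apply: insert_inj => a; rewrite [RHS]insertL !insert_pull scalerDr.
by rewrite !insertL !IH epsL; zmod_eq.
Qed.

Lemma ext_act_linear x : linear (ext_act x).
Proof. by move=> c u v; rewrite /ext_act !bl epsl scalerDr; zmod_eq. Qed.

Lemma ext_act_inl x m :
  ext_act x (inl m) = inl (act (S x) m) + eps (inl (act x m)).
Proof. by rewrite /ext_act !b_inl. Qed.

Lemma eps_ext_act x v : eps (ext_act x v) = ext_act x (eps v).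
Proof. by rewrite /ext_act (linD epsl) !b_eps. Qed.

Notation lieM := (ce_lie br act).
Notation lieN := (ce_lie desc_br ext_act).
Notation diffM := (ce_diff br act).
Notation diffN := (ce_diff desc_br ext_act).
Let lieN_l n a := @lie_linear k L N desc_br ext_act ext_act_linear n a.
Let diffN_l n := @diff_linear k L N desc_br ext_act ext_act_linear n.
Let epsLie n a (F : ('I_n -> L) -> N) :=
  comp_lie desc_br epsl eps_ext_act a F.
Let epsDiff n (F : ('I_n -> L) -> N) :=
  comp_diff desc_br epsl eps_ext_act F.

(** After applying [i_c] this comes down to [phi [a, c]_S = [phi a, phi c]], which follows from
    [S_eq] and from [eps_eq] for the term [eps^2 [a, c]]. *)
Lemma lie_pull n a (f : ('I_n -> L) -> M) : alt_hom f ->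
  lieN a (pull f) = pull (lieM (S a) f) + (eps \o pull (lieM a f)).
Proof.
elim: n f => [|n IH] f fA; first by apply/funext => x; exact: ext_act_inl.
apply: insert_inj => c; rewrite insert_lie insert_pull.
rewrite (linD (@lieN_l _ _)) -epsLie !IH; try exact: alt_insert.
rewrite [RHS](_ : _ = insert c (pull (lieM (S a) f))
                + (eps \o insert c (pull (lieM a f)))) //.
rewrite !insert_pull !insert_lie S_eq.
rewrite !(linD (@epsL _)) !(linB (@pull_linear _)) !(linB (@epsL _)).
have epsE (F : ('I_n -> L) -> N) :
  eps \o (eps \o F) = mu *: (eps \o F) - lambda *: F.
  by apply/funext => x; exact: eps_eq.
rewrite !epsE.
rewrite (linB (insert_linear fA)) (linZ (insert_linear fA)).
rewrite /desc_br !(linD (insert_linear fA)) (linZ (insert_linear fA)).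
rewrite (linB (@pull_linear _)) !(linD (@pull_linear _)).
rewrite !(linZ (@pull_linear _)).
rewrite !(linD (@epsL _)) (linZ (@epsL _)).
zmod_eq.
Qed.

Lemma pull_diff n (f : ('I_n -> L) -> M) : alt_hom f ->
  pull (diffM f) = diffN (pull f).
Proof.
elim: n f => [|n IH] f fA; apply: insert_inj => a; rewrite insert_pull.
  by rewrite !insert_diff0 lie_pull.
rewrite !insert_diff (linB (@pull_linear _) (lieM (S a) f)).
rewrite (linB (@pull_linear _) (lieM a f)) (linB (@epsL _)) lie_pull //.
rewrite insert_pull (linD (@diffN_l _)) -epsDiff !IH; try exact: alt_insert.
zmod_eq.
Qed.

(** In [i_a i_a (pull f)] the terms from [i_(S a) i_(S a) f] and [i_a i_a f] vanish, and the two
    mixed ones, each with one factor [eps], cancel. *)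
Lemma alt_pull n (f : ('I_n -> L) -> M) : alt_hom f -> alt_hom (pull f).
Proof.
elim: n f => [|n IH] f fA; first exact: alt_of0.
have pullA a : alt_hom (insert a (pull f)).
  rewrite insert_pull -[X in X + _]scale1r; apply: alt_lin.
    exact/IH/alt_insert.
  by apply: alt_comp => //; exact/IH/alt_insert.
have pulll : linear (fun a => insert a (pull f)).
  move=> c u v; rewrite !insert_pull Sl !(insert_linear fA) !pull_linear.
  by rewrite epsL scalerDr; zmod_eq.
case: n => [|n] in f fA IH pullA pulll *; first exact: alt_of1.
apply: alt_ofSS => // a z; rewrite -!insertE insert_pull.
rewrite [insert a _](_ : _ = insert a (pull (insert (S a) f))
   + (eps \o insert a (pull (insert a f)))) // !insert_pull.
rewrite !insert_diag // (lin0 (@pull_linear _)) (linD (@epsL _)).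
rewrite (lin0 (@epsL _)) (lin0 (@epsL _)) add0r addr0.
rewrite -(linD (@epsL _)) -(linD (@pull_linear _)).
rewrite [_ + _](_ : _ = 0) ?(lin0 (@pull_linear _)) ?(lin0 (@epsL _)) //.
by apply/funext => y; rewrite -[LHS]/(f _ + f _) alt_swap_head // addNr.
Qed.

End Pullback.

(** * Sums over shuffles *)

Section Shuffles.

Variable n : nat.
Implicit Types (I : {ffun 'I_n -> bool}) (tau : 'S_n) (p : nat).

(** The image under [tau] of [{0, .., p-1}], as a characteristic function; it determines a
    shuffle. *)
Definition first_block p tau : {ffun 'I_n -> bool} :=
  [ffun j => ((tau^-1)%g j < p)%N].

(* The strict order that puts the elements of I before the others; the
   shuffle with first block I enumerates 'I_n increasingly for it. *)
Definition block_lt I (i j : 'I_n) : bool :=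
  if I i == I j then (i < j)%N else I i.

Definition block_seq I : seq 'I_n :=
  [seq i <- enum 'I_n | I i] ++ [seq i <- enum 'I_n | ~~ I i].

(** The exponent of [eps] in the term indexed by [I]. *)
Definition co_size m (I : {ffun 'I_m -> bool}) : nat := \sum_(i < m) ~~ I i.

Lemma pairwise_enum_ord : pairwise (fun i j : 'I_n => (i < j)%N) (enum 'I_n).
Proof.
have := pairwise_map val ltn (enum 'I_n); rewrite val_enum_ord => <-.
by rewrite -sorted_pairwise ?iota_ltn_sorted //; exact: ltn_trans.
Qed.

Lemma block_lt_trans I : transitive (block_lt I).
Proof.
move=> j i l; rewrite /block_lt.
by case: (I i); case: (I j); case: (I l) => //=; apply: ltn_trans.
Qed.

Lemma block_lt_irr I : irreflexive (block_lt I).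
Proof. by move=> i; rewrite /block_lt eqxx ltnn. Qed.

Lemma perm_block_seq I : perm_eq (block_seq I) (enum 'I_n).
Proof. exact: permEl (perm_filterC _ _). Qed.

Lemma size_block_seq I : size (block_seq I) = n.
Proof. by rewrite (perm_size (perm_block_seq I)) size_enum_ord. Qed.

Lemma block_seq_pairwise I : pairwise (block_lt I) (block_seq I).
Proof.
have pf (b : bool) : pairwise (block_lt I) [seq i <- enum 'I_n | I i == b].
  apply: (sub_in_pairwise (P := [pred i | I i == b])
            (r := fun i j : 'I_n => (i < j)%N)).
  - by move=> i j; rewrite /block_lt !inE => /eqP-> /eqP->; rewrite eqxx.
  - by apply/allP => i; rewrite mem_filter => /andP[].
  - exact/pairwise_filter/pairwise_enum_ord.
rewrite pairwise_cat; apply/and3P; split.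
- apply/allrelP => i j; rewrite !mem_filter => /andP[Ii _] /andP[/negbTE Ij _].
  by rewrite /block_lt Ii Ij.
- by rewrite -(eq_filter (a1 := fun i => I i == true)) // => i; rewrite eqb_id.
- by rewrite -(eq_filter (a1 := fun i => I i == false)) // => i; case: (I i).
Qed.

(** The default value [i] is never reached, [block_seq I] having length [n]. *)
Lemma block_shuffle_inj I : injective (fun i : 'I_n => nth i (block_seq I) i).
Proof.
move=> i j; rewrite (set_nth_default j) ?size_block_seq //.
have u : uniq (block_seq I) by rewrite (perm_uniq (perm_block_seq I)) enum_uniq.
by move/eqP; rewrite nth_uniq ?size_block_seq // => /eqP/val_inj.
Qed.

Definition block_shuffle I : 'S_n := perm (@block_shuffle_inj I).

Lemma co_sizeE I : co_size I = (n - size [seq i <- enum 'I_n | I i])%N.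
Proof.
rewrite -[X in (X - _)%N](size_enum_ord n) -(perm_size (perm_block_seq I)).
rewrite size_cat addKn size_filter -sum1_count /co_size [RHS]big_mkcond.
by rewrite [RHS]big_enum; apply: eq_bigr => i _; case: (I i).
Qed.

Lemma shuffle_block_lt p tau (i j : 'I_n) : is_shuffle p tau -> (i < j)%N ->
  block_lt (first_block p tau) (tau i) (tau j).
Proof.
move=> /forallP/(_ i)/forallP/(_ j)/implyP sh ij.
rewrite /block_lt !ffunE !permK.
move: sh; rewrite ij /=; case: (ltnP i p) => ip; case: (ltnP j p) => jp //=;
  first by apply.
- by move=> _; rewrite ltnNge (leq_trans ip (ltnW ij)) in jp.
- by apply.
Qed.

(** The members of [I] fill exactly the first [p] positions of [block_seq I], and within each block
    [block_lt I] is the usual order. *)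
Lemma block_shuffleK p I : (p <= n)%N -> co_size I = (n - p)%N ->
  is_shuffle p (block_shuffle I) /\ first_block p (block_shuffle I) = I.
Proof.
move=> pn cI; have sI : size [seq i <- enum 'I_n | I i] = p.
  have le : (size [seq i <- enum 'I_n | I i] <= n)%N.
    by rewrite -[X in (_ <= X)%N](size_enum_ord n) size_filter count_size.
  by rewrite -(subKn le) -co_sizeE cI subKn.
have II (i : 'I_n) : I (block_shuffle I i) = (i < p)%N.
  rewrite permE nth_cat sI; case: ltnP => ip.
    have := mem_nth i (_ : (i < size [seq i <- enum 'I_n | I i])%N).
    by rewrite sI mem_filter => /(_ ip)/andP[].
  have := mem_nth i (_ : (i - p < size [seq i <- enum 'I_n | ~~ I i])%N).
  rewrite mem_filter => H; apply/negbTE; suff /H/andP[] : 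
    (i - p < size [seq i <- enum 'I_n | ~~ I i])%N by [].
  have := size_block_seq I; rewrite size_cat sI => E.
  by rewrite -(ltn_add2l p) E subnKC.
split; last by apply/ffunP => j; rewrite ffunE -II permKV.
apply/forallP => i; apply/forallP => j; apply/implyP => /andP[ij ijp].
have /(pairwiseP i)/(_ i j) := block_seq_pairwise I.
rewrite !inE size_block_seq !ltn_ord => /(_ isT isT ij).
rewrite [nth i _ j](set_nth_default j) ?size_block_seq //.
have E l : nth l (block_seq I) l = block_shuffle I l by rewrite permE.
rewrite !E /block_lt !II; case: eqP => // ne ip; case/orP: ijp => [jp|pi].
  by move: ne; rewrite jp (ltn_trans ij jp).
by rewrite ltnNge pi in ip.
Qed.

(** The images under [tau] in order and [block_seq I] have the same elements and are both sorted for
    the strict order [block_lt I], hence coincide. *)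
Lemma shuffleK p tau : is_shuffle p tau ->
  block_shuffle (first_block p tau) = tau.
Proof.
move=> sh; set I := first_block p tau.
suff E : map tau (enum 'I_n) = block_seq I.
  apply/permP => i; rewrite permE -E (nth_map i) ?size_enum_ord //.
  by rewrite nth_ord_enum.
apply: (irr_sorted_eq (@block_lt_trans I) (@block_lt_irr I)).
- rewrite (sorted_pairwise (@block_lt_trans I)) pairwise_map.
  apply: sub_pairwise pairwise_enum_ord => i j; exact: shuffle_block_lt.
- by rewrite (sorted_pairwise (@block_lt_trans I)) block_seq_pairwise.
- move=> j; rewrite (perm_mem (perm_block_seq I)) mem_enum.
  by apply/mapP; exists ((tau^-1)%g j); rewrite ?mem_enum // permKV.
Qed.

Lemma co_size_first_block p tau : (p <= n)%N ->
  co_size (first_block p tau) = (n - p)%N.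
Proof.
move=> pn; rewrite /co_size (reindex_inj (@perm_inj _ tau)) /=.
rewrite (eq_bigr (fun i : 'I_n => (p <= i)%N : nat)) => [|i _]; last first.
  by rewrite ffunE permK -leqNgt.
elim: {tau} n pn => [|m IH]; first by rewrite leqn0 => /eqP->; rewrite big_ord0.
rewrite big_ord_recr leq_eqVlt => /predU1P[->|pm] /=.
  by rewrite ltnn subnn big1 // => i _; rewrite leqNgt ltnS ltnW.
by rewrite IH // (pm : (p <= m)%N) addn1 subSn.
Qed.

Lemma sum_shuffles (V : nmodType) p (F : {ffun 'I_n -> bool} -> V) :
  (p <= n)%N ->
  \sum_(tau : 'S_n | is_shuffle p tau) F (first_block p tau)
  = \sum_(I | co_size I == (n - p)%N) F I.
Proof.
move=> pn; rewrite (reindex_onto (first_block p) block_shuffle) => [|I /eqP cI].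
  apply: eq_bigl => tau; rewrite co_size_first_block // eqxx /=.
  apply/idP/eqP => [|<-]; first exact: shuffleK.
  by have [] := block_shuffleK pn (co_size_first_block tau pn).
by have [] := block_shuffleK pn cI.
Qed.

End Shuffles.

Section ShuffleSums.

Variables (k : fieldType) (L M : lmodType k) (S : L -> L).

Definition apply_on n (I : 'I_n -> bool) (x : 'I_n -> L) : 'I_n -> L :=
  fun i => if I i then S (x i) else x i.

(** Undoing the permutation of the arguments produces a second factor [(-1) ^+ tau]. *)
Lemma shuffle_argE n (f : ('I_n -> L) -> M) p (tau : 'S_n) x : alt_hom f ->
  (-1) ^+ tau *: f (shuffle_arg S p tau x)
  = f (apply_on (first_block p tau) x).
Proof.
move=> fA.
have -> : shuffle_arg S p tau x = apply_on (first_block p tau) x \o tau.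
  by apply/funext => i; rewrite /= /apply_on ffunE permK.
by rewrite alt_perm // scalerA -signr_addb addbb scale1r.
Qed.

Lemma co_size_le n (I : {ffun 'I_n -> bool}) : (co_size I <= n)%N.
Proof.
rewrite -[X in (_ <= X)%N]card_ord -sum1_card.
by apply: leq_sum => i _; case: (I i).
Qed.

(** Shuffles of all block sizes [p] amount to all subsets of ['I_n], here grouped by the size
    [n - p] of the complement. *)
Lemma sum_shuffle_arg n (f : ('I_n -> L) -> M) (c : nat -> k) x : alt_hom f ->
  \sum_(0 <= p < n.+1) \sum_(tau : 'S_n | is_shuffle p tau)
      (-1) ^+ tau *: (c (n - p)%N *: f (shuffle_arg S p tau x))
  = \sum_(I : {ffun 'I_n -> bool}) c (co_size I) *: f (apply_on I x).
Proof.
move=> fA.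
pose F (I : {ffun 'I_n -> bool}) := c (co_size I) *: f (apply_on I x).
transitivity (\sum_(0 <= p < n.+1) \sum_(I | co_size I == p) F I).
  rewrite [RHS]big_nat_rev !big_mkord; apply: eq_bigr => p _.
  have pn : (p <= n)%N by rewrite -ltnS.
  rewrite add0n subSS -sum_shuffles //; apply: eq_bigr => tau _.
  rewrite scalerA mulrC -scalerA shuffle_argE // /F.
  by rewrite co_size_first_block.
(* [inord] turns [co_size I] into a finite index for [partition_big]; it loses nothing, as
   [co_size I <= n]. *)
rewrite big_mkord (eq_bigr (fun p : 'I_n.+1 =>
  \sum_(I | (inord (co_size I) : 'I_n.+1) == p) F I)) => [|p _]; last first.
  apply: eq_bigl => I; apply/eqP/eqP => [E|<-]; last first.
    by rewrite inordK // ltnS co_size_le.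
  by apply: val_inj; rewrite /= inordK // ltnS co_size_le.
by rewrite (partition_big (fun I => inord (co_size I) : 'I_n.+1) xpredT).
Qed.

Lemma sum_ffun_ord_recl (V : nmodType) n (F : {ffun 'I_n.+1 -> bool} -> V) :
  \sum_I F I
  = \sum_(I : {ffun 'I_n -> bool}) F [ffun i => tcons true I i]
    + \sum_(I : {ffun 'I_n -> bool}) F [ffun i => tcons false I i].
Proof.
pose h (u : bool * {ffun 'I_n -> bool}) : {ffun 'I_n.+1 -> bool} :=
  [ffun i => tcons u.1 u.2 i].
rewrite (reindex h) /=; last first.
  exists (fun I => (I ord0, [ffun j => I (lift ord0 j)])) => [[c I] _|I _].
    by congr (_, _); last apply/ffunP => j; rewrite !ffunE ?tcons0 ?tconsS.
  apply/ffunP => i; rewrite ffunE /=.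
  by case: (unliftP ord0 i) => [j|] ->; rewrite ?tcons0 ?tconsS ?ffunE.
rewrite -(pair_bigA _ (fun c I => F (h (c, I)))) /=.
by rewrite big_bool.
Qed.

Lemma co_size_tcons n c (I : {ffun 'I_n -> bool}) :
  co_size [ffun i => tcons c I i] = (~~ c + co_size I)%N.
Proof.
rewrite /co_size big_ord_recl ffunE tcons0; congr (_ + _)%N.
by apply: eq_bigr => i _; rewrite ffunE tconsS.
Qed.

Lemma apply_on_tcons n c (I : {ffun 'I_n -> bool}) a y :
  apply_on [ffun i => tcons c I i] (tcons a y)
  = tcons (if c then S a else a) (apply_on I y).
Proof.
by apply: tuple_eqP => [|j]; rewrite /apply_on ffunE ?tcons0 ?tconsS.
Qed.

Variables (N : lmodType k) (inl : M -> N) (eps : N -> N).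
Hypothesis epsl : linear eps.

(** Entry [i] contributes [S x_i] when [i] is in [I] and [eps x_i] otherwise. *)
Lemma pull_sum n (f : ('I_n -> L) -> M) x :
  pull S inl eps f x
  = \sum_(I : {ffun 'I_n -> bool})
      iter (co_size I) eps (inl (f (apply_on I x))).
Proof.
elim: n f x => [|n IH] f x.
  have all0 (I : {ffun 'I_0 -> bool}) : I = [ffun=> true] by apply/ffunP => -[].
  rewrite (bigD1 [ffun=> true]) //= big1 ?addr0 => [|I]; last first.
    by rewrite (all0 I) eqxx.
  rewrite /co_size big_ord0 /=; congr (inl (f _)).
  by apply/funext => -[].
rewrite /= -[in RHS](tcons_eta x) !IH sum_ffun_ord_recl.
rewrite (big_morph eps (linD epsl) (lin0 epsl)).
by congr (_ + _); apply: eq_bigr => I _; rewrite co_size_tcons apply_on_tcons.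
Qed.

End ShuffleSums.

(** * The complex of an extended Rota-Baxter Lie algebra *)

Lemma RBA_subspace (k : fieldType) (h W : lmodType k) n :
  is_subspace (@RBA_cochain k h W n).
Proof.
have altS m := @alt_subspace k h W m.
split=> [|c [f f'] [e e'] [/= fA f'A] [/= eA e'A]].
  by split; [exact: (altS n).1 | case: n => [|n] //; exact: (altS n).1].
split; first exact: (altS n).2.
case: n f f' e e' f'A e'A {fA eA} => [|n] f f' e e' /= f'A e'A.
  by rewrite f'A e'A scaler0 addr0.
exact: (altS n).2.
Qed.

Section ExtendedRotaBaxter.

Variables (k : fieldType) (mu lambda : k) (h : lmodType k).
Variables (br : h -> h -> h) (S : h -> h).
Hypothesis hP : is_extRB_lie mu lambda br S.

Let brP : is_lie_bracket br := extRB_lie hP.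
Let Sl : linear S := extRB_linear hP.
Let brl y : linear (br^~ y) := lie_linearl brP y.
Let brr x : linear (br x) := lie_linearr brP x.

Notation dbr := (desc_br mu br S).

Definition desc_act (x v : h) : h := br (S x) v - S (br x v).

Lemma adjoint_rep : is_lie_rep br br.
Proof.
by split; [exact: brl | exact: brr | move=> a b m; exact: br_jacobi].
Qed.

Lemma op_desc_br x y : S (dbr x y) = br (S x) (S y) - lambda *: br x y.
Proof. by rewrite (extRB_eq hP) /desc_br addrK. Qed.

Lemma desc_br_lie : is_lie_bracket dbr.
Proof.
split.
- move=> y c u v; rewrite /desc_br Sl !brl !scalerDr !scalerA [c * mu]mulrC.
  by rewrite -!addrA; zmod_eq.
- move=> x c u v; rewrite /desc_br Sl !brr !scalerDr !scalerA [c * mu]mulrC.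
  by zmod_eq.
- move=> x; rewrite /desc_br [br x (S x)](br_anti brP) addrN.
  by rewrite (lie_alternating brP) scaler0 addr0.
move=> x y z.
have D u v w : dbr u (dbr v w)
  = br (S u) (br (S v) w) + br (S u) (br v (S w)) + mu *: br (S u) (br v w)
    + (br u (br (S v) (S w)) - lambda *: br u (br v w))
    + (mu *: br u (br (S v) w) + mu *: br u (br v (S w))
       + mu *: (mu *: br u (br v w))).
  rewrite {1}/desc_br op_desc_br (linB (@brr _)) /desc_br.
  by rewrite !(linD (@brr _)) !(linZ (@brr _)) !scalerDr.
have J u v w : br w (br u v) = - br u (br v w) - br v (br w u).
  have := lie_jacobi brP u v w => /eqP.
  by rewrite addrC addr_eq0 opprD => /eqP.
rewrite !D.
(* The cyclic sum splits into Jacobi sums of the seven triples with at most two entries under [S];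
   [J] eliminates one term of each. *)
rewrite (J x y z) (J (S x) (S y) z) (J (S x) y (S z)) (J x (S y) (S z)).
rewrite (J (S x) y z) (J x (S y) z) (J x y (S z)).
rewrite !scalerBr !scalerN.
zmod_eq.
Qed.

Lemma desc_act_rep : is_lie_rep dbr desc_act.
Proof.
split.
- move=> m c u v; rewrite /desc_act Sl !brl Sl scalerBr; zmod_eq.
- move=> a c u v; rewrite /desc_act !brr Sl scalerBr; zmod_eq.
move=> a b m.
(* [extRB_eq] on [[S u, S [w, m]]] cancels the term [S [u, S [w, m]]]; Jacobi then applies to every
   iterated bracket left. *)
have D u w : desc_act u (desc_act w m)
   = br (S u) (br (S w) m) - S (br (S u) (br w m)) - mu *: S (br u (br w m))
     - lambda *: br u (br w m) - S (br u (br (S w) m)).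
  rewrite /desc_act !(linB (@brr _)) (linB Sl) (extRB_eq hP).
  by rewrite !(linD Sl) (linZ Sl); zmod_eq.
rewrite !D /desc_act op_desc_br (linB (@brl _)) (linZ (@brl _)) /desc_br.
rewrite !(linD (@brl _)) (linZ (@brl _)) !(linD Sl) (linZ Sl) !(br_jacobi brP).
rewrite !(linB Sl) !scalerBr.
zmod_eq.
Qed.

(* (u, w) stands for u + eps w in h (x) R. *)
Definition dual_eps (v : h * h) : h * h := (- (lambda *: v.2), v.1 + mu *: v.2).
Definition dual_inl (m : h) : h * h := (m, 0).
Definition dual_br (x : h) (v : h * h) : h * h := (br x v.1, br x v.2).
Definition dual_proj (v : h * h) : h := v.1 - S v.2.

Notation pull := (pull S dual_inl dual_eps).
Notation dual_act := (ext_act S dual_eps dual_br).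

Lemma pairE (a b c d : h) : a = c -> b = d -> (a, b) = (c, d).
Proof. by move=> -> ->. Qed.

Lemma dual_eps_linear : linear dual_eps.
Proof.
move=> c u v; apply: pairE => /=.
  rewrite scalerDr !scalerA mulrC -!scalerA scalerN; zmod_eq.
by rewrite !scalerDr !scalerA [mu * c]mulrC; zmod_eq.
Qed.

Lemma dual_inl_linear : linear dual_inl.
Proof. by move=> c u v; apply: pairE; rewrite //= scaler0 addr0. Qed.

Lemma dual_proj_linear : linear dual_proj.
Proof. by move=> c u v; rewrite /dual_proj /= Sl scalerBr; zmod_eq. Qed.

Lemma dual_br_linear x : linear (dual_br x).
Proof. by move=> c u v; apply: pairE; rewrite /= brr. Qed.

Lemma dual_br_inl x m : dual_br x (dual_inl m) = dual_inl (br x m).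
Proof. by apply: pairE => //=; exact: (lin0 (@brr x)). Qed.

Lemma dual_br_eps x v : dual_br x (dual_eps v) = dual_eps (dual_br x v).
Proof.
apply: pairE => /=; first by rewrite (linN (@brr x)) (linZ (@brr x)).
by rewrite (linD (@brr x)) (linZ (@brr x)).
Qed.

Lemma dual_eps_eq v : dual_eps (dual_eps v) = mu *: dual_eps v - lambda *: v.
Proof.
case: v => u w; apply: pairE => /=.
  by rewrite scalerDr scalerN !scalerA [mu * _]mulrC; zmod_eq.
by rewrite scalerDr; zmod_eq.
Qed.

(** For [v = (u, w)] the two sides differ exactly by the extended Rota-Baxter equation at [x] and
    [w]. *)
Lemma dual_proj_act x v : dual_proj (dual_act x v) = desc_act x (dual_proj v).
Proof.
case: v => u w; rewrite /dual_proj /desc_act /= !(linB (@brr _)) (extRB_eq hP).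
rewrite (linB Sl) !(linD Sl) (linZ Sl); zmod_eq.
Qed.

Lemma iter_dual_eps m v :
  iter m dual_eps (dual_inl v)
  = (- (A mu lambda (m%:Z - 1) *: v), B mu lambda m *: v).
Proof.
elim: m => [|m IH].
  by apply: pairE; rewrite /= ?scale0r // scaleN1r opprK.
have -> : (m.+1%:Z - 1 = m%:Z)%R by rewrite -addn1 PoszD addrK.
rewrite iterS IH; apply: pairE => /=; first by rewrite scalerA.
(* The recurrence of [B] starts at index 2; the first power of [eps] is obtained from
   [A_(-1) = -1]. *)
case: m {IH} => [|m].
  by rewrite /= scale0r scaler0 addr0 scaleN1r opprK scale1r.
have -> : (m.+1%:Z - 1 = m%:Z)%R by rewrite -addn1 PoszD addrK.
rewrite [in RHS]/B -/(B mu lambda m.+1) -/(B mu lambda m).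
by rewrite scalerA -scaleNr -scalerDl addrC.
Qed.

Lemma deltaE n (f : ('I_n -> h) -> h) : alt_hom f ->
  delta mu lambda S f = dual_proj \o pull f.
Proof.
move=> fA; apply/funext => x; rewrite /= (pull_sum _ _ dual_eps_linear).
have -> : \sum_(I : {ffun 'I_n -> bool})
    iter (co_size I) dual_eps (dual_inl (f (apply_on S I x)))
  = (- \sum_(I : {ffun 'I_n -> bool})
         A mu lambda ((co_size I)%:Z - 1) *: f (apply_on S I x),
     \sum_(I : {ffun 'I_n -> bool})
         B mu lambda (co_size I) *: f (apply_on S I x)).
  rewrite -sumrN; apply: (big_ind3 (fun u v w => u = (v, w))) => //.
    by move=> ? ? ? ? ? ? -> ->.
  by move=> I _; exact: iter_dual_eps.
rewrite /dual_proj /=; congr (- _ - _).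
  rewrite -(sum_shuffle_arg S (fun m => A mu lambda (m%:Z - 1)) x fA).
  apply: eq_big_nat => p /andP[_ pn]; apply: eq_bigr => tau _.
  by rewrite subzn.
rewrite (big_morph S (linD Sl) (lin0 Sl)).
rewrite (eq_bigr _ (fun I _ => linZ Sl _ _)).
rewrite -(sum_shuffle_arg S (B mu lambda) x (alt_comp Sl fA)).
(* The term [p = n] has coefficient [B_0 = 0]; dropping it and shifting [p] by one gives the range
   of the second sum in [delta]. *)
rewrite [RHS]big_nat_recr // subnn [X in _ = _ X]big1 ?Monoid.mulm1; last first.
  by move=> tau _; rewrite scale0r scaler0.
rewrite big_add1; apply: eq_big_nat => p /andP[_ pn]; apply: eq_bigr => tau _.
by rewrite subnSK.
Qed.

Lemma d_LieE n (f : ('I_n -> h) -> h) : alt_hom f ->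
  d_Lie br f = (-1) ^+ n.+1 *: ce_diff br br f.
Proof. by move=> fA; rewrite -ce_sumE. Qed.

Lemma d_RBE n (f : ('I_n -> h) -> h) : alt_hom f ->
  d_RB mu br S f = (-1) ^+ n.+1 *: ce_diff dbr desc_act f.
Proof. by move=> fA; rewrite -ce_sumE. Qed.

Lemma alt_d_Lie n (f : ('I_n -> h) -> h) : alt_hom f -> alt_hom (d_Lie br f).
Proof.
move=> fA; rewrite d_LieE //.
exact: alt_scale (alt_diff brP adjoint_rep fA).
Qed.

Lemma alt_d_RB n (f : ('I_n -> h) -> h) : alt_hom f -> alt_hom (d_RB mu br S f).
Proof.
move=> fA; rewrite d_RBE //.
exact: alt_scale (alt_diff desc_br_lie desc_act_rep fA).
Qed.

Lemma alt_delta n (f : ('I_n -> h) -> h) :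
  alt_hom f -> alt_hom (delta mu lambda S f).
Proof.
move=> fA; rewrite deltaE //; apply: (alt_comp dual_proj_linear).
by apply: alt_pull => //; [exact: dual_inl_linear | exact: dual_eps_linear].
Qed.

Lemma d_Lie_lin n c (f f' : ('I_n -> h) -> h) : alt_hom f -> alt_hom f' ->
  d_Lie br (c *: f + f') = c *: d_Lie br f + d_Lie br f'.
Proof.
move=> fA fA'; rewrite !d_LieE //; last exact: alt_lin.
by rewrite (diff_linear br brr) scalerDr !scalerA mulrC.
Qed.

Lemma d_RB_lin n c (f f' : ('I_n -> h) -> h) : alt_hom f -> alt_hom f' ->
  d_RB mu br S (c *: f + f') = c *: d_RB mu br S f + d_RB mu br S f'.
Proof.
move=> fA fA'; rewrite !d_RBE //; last exact: alt_lin.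
by rewrite (diff_linear dbr (rep_linearr desc_act_rep)) scalerDr !scalerA mulrC.
Qed.

Lemma delta_lin n c (f f' : ('I_n -> h) -> h) : alt_hom f -> alt_hom f' ->
  delta mu lambda S (c *: f + f')
  = c *: delta mu lambda S f + delta mu lambda S f'.
Proof.
move=> fA fA'; rewrite !deltaE //; last exact: alt_lin.
rewrite (pull_linear S dual_inl_linear dual_eps_linear).
exact: (comp_linear dual_proj_linear).
Qed.

Lemma d_Lie_d_Lie n (f : ('I_n -> h) -> h) :
  alt_hom f -> d_Lie br (d_Lie br f) = 0.
Proof.
move=> fA; rewrite d_LieE; last exact: alt_d_Lie.
rewrite d_LieE // (linZ (@diff_linear _ _ _ br br brr _)).
by rewrite (diff_diff brP adjoint_rep fA) !scaler0.
Qed.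

Lemma d_RB_d_RB n (f : ('I_n -> h) -> h) :
  alt_hom f -> d_RB mu br S (d_RB mu br S f) = 0.
Proof.
move=> fA; rewrite d_RBE; last exact: alt_d_RB.
rewrite d_RBE // (linZ (@diff_linear _ _ _ dbr _ (rep_linearr desc_act_rep) _)).
by rewrite (diff_diff desc_br_lie desc_act_rep fA) !scaler0.
Qed.

Lemma delta_d_Lie n (f : ('I_n -> h) -> h) : alt_hom f ->
  delta mu lambda S (d_Lie br f) = d_RB mu br S (delta mu lambda S f).
Proof.
move=> fA; rewrite d_RBE; last exact: alt_delta.
rewrite deltaE; last exact: alt_d_Lie.
rewrite d_LieE // deltaE //.
rewrite (linZ (@pull_linear _ _ _ _ S _ _ dual_inl_linear dual_eps_linear _)).
rewrite (pull_diff (act := br) op_desc_br dual_inl_linear dual_eps_linear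
  dual_br_inl dual_br_eps dual_br_linear dual_eps_eq fA).
rewrite -(comp_diff dbr dual_proj_linear dual_proj_act).
exact: (linZ (@comp_linear _ _ _ _ dual_proj_linear _)).
Qed.

Lemma RBA_cochain_complex :
  is_cochain_complex (@d_RBA k mu lambda _ br S) (@RBA_cochain k h h).
Proof.
have altN n (f : ('I_n -> h) -> h) : alt_hom f -> alt_hom (- f).
  by move=> fA; rewrite -scaleN1r; apply: alt_scale.
have d_RB_N n (f : ('I_n -> h) -> h) : alt_hom f ->
    d_RB mu br S (- f) = - d_RB mu br S f.
  move=> fA; rewrite !d_RBE //; last exact: altN.
  rewrite (linN (@diff_linear _ _ _ dbr _ (rep_linearr desc_act_rep) _)).
  by rewrite scalerN.
(* In degree 0 the second component is a placeholder and [d_RBA] has no [d_RB] term. *)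
case=> [|n]; split.
- exact: RBA_subspace.
- by move=> [f f'] [/= fA _]; split; [exact: alt_d_Lie | exact/altN/alt_delta].
- move=> c [f f'] [e e'] [/= fA _] [/= eA _]; congr (_, _).
    exact: d_Lie_lin.
  by rewrite /= delta_lin // opprD scalerN.
- move=> [f f'] [/= fA _]; congr (_, _); first exact: d_Lie_d_Lie.
  rewrite /= d_RB_N ?delta_d_Lie ?opprK ?subrr //; exact: alt_delta.
- exact: RBA_subspace.
- move=> [f f'] [/= fA f'A]; split; first exact: alt_d_Lie.
  by apply: alt_sub; [exact/altN/alt_d_RB | exact: alt_delta].
- move=> c [f f'] [e e'] [/= fA f'A] [/= eA e'A]; congr (_, _).
    exact: d_Lie_lin.
  rewrite /= [RHS](congr1 (+%R^~ _) (scalerBr _ _ _)).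
  by rewrite delta_lin // d_RB_lin // scalerN; zmod_eq.
- move=> [f f'] [/= fA f'A]; congr (_, _); first exact: d_Lie_d_Lie.
  (* The second component reduces to [d_RB (delta f) - delta (d_Lie f)]. *)
  rewrite /= -[- d_RB _ _ _ f']scaleN1r d_RB_lin;
    [|exact: alt_d_RB|exact/altN/alt_delta].
  rewrite d_RB_d_RB // scaler0 add0r d_RB_N; last exact: alt_delta.
  by rewrite delta_d_Lie // opprK subrr.
Qed.

End ExtendedRotaBaxter.

(** * Coefficients in a representation *)

Section Coefficients.

Variables (k : fieldType) (g V : lmodType k).

Definition at_g n (x : 'I_n -> g) : 'I_n -> g * V := fun i => (x i, 0).

(** Lets alternation of a differential with coefficients be inherited from the complex of the
    semi-direct product. *)
Lemma alt_ext_inv n (f : ('I_n -> g) -> V) : alt_hom (ext f) -> alt_hom f.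
Proof.
move=> [fl fa]; split=> [x i c u v|x i j ij xij]; last first.
  by have [] := fa (at_g x) i j ij (congr1 (fun a => (a, 0)) xij).
have := congr1 snd (fl (at_g x) i c (u, 0) (v, 0)); rewrite /ext /=.
have E (w : g * V) : (fun l => ([eta at_g x with i |-> w] l).1)
             = [eta x with i |-> w.1] :> ('I_n -> g).
  by apply/funext => l /=; case: ifP.
by rewrite !E.
Qed.

Lemma sum_pair0 (I : Type) (r : seq I) (P : pred I) (F : I -> V) :
  \sum_(i <- r | P i) ((0, F i) : g * V) = (0, \sum_(i <- r | P i) F i).
Proof.
apply: (big_ind2 (fun u v => u = (0, v))) => // u a v b -> ->.
by congr (_, _); rewrite /= addr0.
Qed.

Lemma pair0D (u v : V) : ((0, u) : g * V) + (0, v) = (0, u + v).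
Proof. by congr (_, _); rewrite /= addr0. Qed.

Lemma pair0Z c (u : V) : c *: ((0, u) : g * V) = (0, c *: u).
Proof. by congr (_, _); rewrite /= scaler0. Qed.

Lemma pair0N (u : V) : - ((0, u) : g * V) = (0, - u).
Proof. by congr (_, _); rewrite /= oppr0. Qed.

Lemma ext_lin n c (f f' : ('I_n -> g) -> V) :
  ext (c *: f + f') = c *: ext f + ext f'.
Proof.
apply/funext => x; rewrite /ext -[RHS]/(c *: (0, f _) + (0, f' _)).
by rewrite pair0Z pair0D.
Qed.

(** Serves both [d_Lie] and [d_RB]: values in [V] stay in [V], and [ext f] sees a bracket only
    through its component in [g]. *)
Lemma ce_sum_ext n (br : g -> g -> g) (act : g -> V -> V)
    (br' : g * V -> g * V -> g * V) (act' : g * V -> g * V -> g * V)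
    (f : ('I_n -> g) -> V) :
  (forall x y, (br' x y).1 = br x.1 y.1) ->
  (forall x v, act' x (0, v) = (0, act x.1 v)) ->
  ce_sum br' act' (ext f) = ext (ce_sum br act f).
Proof.
move=> brE actE; apply/funext => x; rewrite /ce_sum /ext.
under eq_bigr do rewrite actE pair0Z.
under [X in _ + X]eq_bigr do
  (under eq_bigr do rewrite pair0Z; rewrite sum_pair0).
rewrite !sum_pair0 pair0D; congr (_, _ + _).
apply: eq_bigr => i _; apply: eq_bigr => j _; congr (_ *: f _).
by apply/funext => l; rewrite /contract; case: ifP.
Qed.

(** [T 0 = 0] makes [sd_op] preserve [V], where [ext f] takes its values. *)
Lemma delta_ext n (mu lambda : k) (T : g -> g) (TV : V -> V)
    (f : ('I_n -> g) -> V) : T 0 = 0 ->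
  exists f', delta mu lambda (sd_op T TV) (ext f) = ext f'.
Proof.
move=> T0.
pose F1 x := \sum_(0 <= p < n.+1) \sum_(tau : 'S_n | is_shuffle p tau)
  (-1) ^+ tau *: (A mu lambda (n%:Z - p%:Z - 1) *: f (shuffle_arg T p tau x)).
pose F2 x := \sum_(1 <= p < n.+1) \sum_(tau : 'S_n | is_shuffle p.-1 tau)
  (-1) ^+ tau *: (B mu lambda (n - p).+1 *: TV (f (shuffle_arg T p.-1 tau x))).
exists (fun x => - F1 x - F2 x); apply/funext => x.
have E p (tau : 'S_n) : (fun i => (shuffle_arg (sd_op T TV) p tau x i).1)
    = shuffle_arg T p tau (fun i => (x i).1).
  by apply/funext => i; rewrite /shuffle_arg; case: ifP.
rewrite -[RHS]/((0, - F1 _ - F2 _)) -pair0D -!pair0N /F1 /F2 -!sum_pair0.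
congr (- _ - _); apply: eq_bigr => p _; rewrite -sum_pair0;
  apply: eq_bigr => tau _.
  by rewrite /ext E !pair0Z.
by rewrite /ext E /sd_op /= T0 !pair0Z.
Qed.

End Coefficients.

Theorem mainTheorem7 (k : fieldType) (char0 : [pchar k] =i pred0)
  (mu lambda : k) (sqrtD : exists r : k, r ^+ 2 = mu ^+ 2 - 4%:R * lambda)
  (g : lmodType k) (br : g -> g -> g) (T : g -> g)
  (gT : is_extRB_lie mu lambda br T)
  (V : lmodType k) (rho : g -> V -> V) (TV : V -> V)
  (VT : is_extRB_rep mu lambda br T rho TV) :
  is_subcomplex (@d_RBA k mu lambda _ (sd_bracket br rho) (sd_op T TV))
    (@RBA_coef_cochain k g V) (@RBA_cochain k (g * V)%type (g * V)%type).
Proof.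
have hP := sd_extRB_lie gT VT.
have cplx := RBA_cochain_complex hP.
have incl : forall n x, @RBA_coef_cochain k g V n x ->
    @RBA_cochain k (g * V)%type (g * V)%type n x.
  move=> n _ [[f f'] [/= fA f'A] <-]; split; first exact: ext_alt_hom.
  case: n f f' f'A {fA} => [|n] f f' /= f'A; last exact: ext_alt_hom.
  by rewrite f'A.
split=> // n; split; [|exact: incl|].
  have [S0 SL] := @RBA_subspace k g V n.
  split=> [|c _ _ [u uC <-] [v vC <-]]; first by exists 0.
  exists (c *: u + v); first exact: SL.
  by rewrite /nat_inj !ext_lin.
move=> _ [[f f'] [/= fA f'A] <-].
have rho0 x : rho x 0 = 0 := lin0 (rep_linearr (extRB_rep VT) x).
have br0 x : br x 0 = 0 := lin0 (lie_linearr (extRB_lie gT) x).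
have rhol0 m : rho 0 m = 0 := lin0 (rep_linearl (extRB_rep VT) m).
have T0 := lin0 (extRB_linear gT).
have sdE x v : sd_bracket br rho x (0, v) = (0, rho x.1 v).
  by rewrite /sd_bracket /= br0 rhol0 subr0.
have LieE m (e : ('I_m -> g) -> V) :
    d_Lie (sd_bracket br rho) (ext e) = ext (ce_sum br rho e).
  exact: ce_sum_ext.
have RBE m (e : ('I_m -> g) -> V) : exists e',
    d_RB mu (sd_bracket br rho) (sd_op T TV) (ext e) = ext e'.
  exists (ce_sum (desc_br mu br T) (fun x v => rho (T x) v - TV (rho x v)) e).
  rewrite -[LHS]/(ce_sum (desc_br mu (sd_bracket br rho) (sd_op T TV))
    (desc_act (sd_bracket br rho) (sd_op T TV)) (ext e)).
  apply: ce_sum_ext => // x v; rewrite /desc_act.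
  by rewrite !sdE /sd_op /= T0 pair0N pair0D.
have fC := incl n _ (ex_intro2 _ _ (f, f') (conj fA f'A) erefl).
have [_ /(_ _ fC) dC _ _] := cplx n; clear fC.
have [e1 e1E] := delta_ext mu lambda TV f T0.
(* Only the shape of the image is left to check: alternation of [c] follows from [dC] by
   [alt_ext_inv]. *)
suff [c cE] : exists c : RBA_space g V n.+1,
    d_RBA mu lambda (sd_bracket br rho) (sd_op T TV) (nat_inj (f, f'))
    = nat_inj c.
  exists c => //; move: dC; rewrite cE => -[/= c1A c2A].
  by split; exact: alt_ext_inv.
have extN m (e : ('I_m -> g) -> V) : - ext e = ext (- e).
  by apply/funext => x; rewrite [LHS]pair0N.
case: n f f' fA f'A dC e1 e1E => [|n] f f' fA f'A dC e1 e1E.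
  by exists (ce_sum br rho f, - e1); congr (_, _);
    [exact: LieE | rewrite /= e1E extN].
have [e2 e2E] := RBE _ f'.
exists (ce_sum br rho f, - e2 - e1); congr (_, _); first exact: LieE.
by rewrite /= e1E e2E !extN -[ext (- e2)]scale1r -ext_lin scale1r.
Qed.
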